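(* Let $\vec{G}=(\mathcal{V},\vec{\mathcal{E}})$ be a directed acyclic graph with $n$ vertices such that the longest directed path in $\vec{G}$ has length $\ell\geq 1$. If $\vec{G}$ is reduced, then $\vec{G}$ has at most $t(n-\ell+1,2)+T(n,\ell,1)$ edges.
   Context: A directed acyclic graph (DAG) is a simple directed graph without directed cycles. A directed path from $v$ to $w$ is a sequence of vertices $v=v_0,\dots,v_k=w$ such that $(v_{i-1},v_i)$ is a directed edge for every $1\le i\le k$; its length is $k$ (the number of edges). For directed paths $\gamma,\gamma'$ from $v$ to $w$, write $\gamma\le\gamma'$ if every vertex of $\gamma$ is also a vertex of $\gamma'$. A finite DAG is reduced if for every pair of vertices $v,w$ and every pair of directed paths $\gamma,\gamma'$ from $v$ to $w$, there exists a directed path $\gamma''$ from $v$ to $w$ such that $\gamma\le\gamma''$ and $\gamma'\leq \gamma''$. $t(m,2)$ denotes the number of edges of the $2$-partite Turán graph on $m$ vertices (the complete bipartite graph on $m$ vertices with part sizes differing by at most one), and $$T(n,\ell,1)=\binom{n}{2}-\binom{n-\ell+1}{2}=(n-\ell+1)(\ell-1)+\frac{(\ell-1)(\ell-2)}{2}.$$ *)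

(* Defs.v *)
From mathcomp Require Import all_boot.

Set Implicit Arguments.
Unset Strict Implicit.
Unset Printing Implicit Defensive.

(* A digraph without multiple edges is a relation e; [e x y] is the edge (x, y). *)

Section Digraph.
Variables (V : finType) (e : rel V).

(* [cycle e c] holds for [c = [:: x]] iff x carries a loop, and for
   [c = [:: x; y]] iff both (x, y) and (y, x) are edges, so being a DAG also
   rules out loops and pairs of opposite edges.  The empty sequence is always
   a (degenerate) [cycle]. *)
Definition is_dag : Prop := forall c : seq V, cycle e c -> c = [::].

(* The path v = v_0, ..., v_k = w is represented by v and p = [:: v_1; ...; v_k];
   its length is [size p] and its vertices are those of [v :: p]. *)
Definition dipath (v w : V) (p : seq V) : bool :=
  path e v p && (last v p == w).

Definition longest_dipath_length (l : nat) : Prop :=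
  (exists v w p, dipath v w p /\ size p = l) /\
  (forall v w p, dipath v w p -> size p <= l).

Definition dipath_le (v : V) (p q : seq V) : Prop :=
  {subset v :: p <= v :: q}.

Definition reduced : Prop :=
  forall v w p p', dipath v w p -> dipath v w p' ->
  exists q, [/\ dipath v w q, dipath_le v p q & dipath_le v p' q].

Definition edges : {set V * V} := [set xy | e xy.1 xy.2].

End Digraph.

(* The r parts of the Turan graph are the residue classes mod r in
   {0, ..., m-1}, whose sizes differ by at most one. *)
Definition turan_rel (m r : nat) : rel 'I_m := fun i j => i %% r != j %% r.

(* t(m, r); the condition i < j counts each undirected edge once. *)
Definition turan_edges (m r : nat) : nat :=
  #|[set ij : 'I_m * 'I_m | (ij.1 < ij.2) && turan_rel r ij.1 ij.2]|.

(* T(n, l, 1); neither subtraction truncates when 1 <= l <= n. *)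
Definition T1 (n l : nat) : nat := 'C(n, 2) - 'C(n - l + 1, 2).

Lemma T1E (n l : nat) : 0 < l <= n ->
  T1 n l = (n - l + 1) * (l - 1) + ((l - 1) * (l - 2)) %/ 2.
Proof.
case: l => [//|k] /= lekn; rewrite /T1 addn1 subnSK // !subSS subn0.
rewrite subn1 divn2 -bin2 -{1}(subnK (ltnW lekn)).
suff -> m : 'C(m + k, 2) = 'C(m, 2) + (m * k + 'C(k, 2)) by rewrite addKn.
elim: k {lekn} => [|k IHk]; first by rewrite muln0 !addn0.
rewrite addnS !binS !bin1 IHk mulnS -!addnA; congr addn.
by rewrite (addnCA _ m k) addnCA.
Qed.

(* Main.v *)
Require Import Defs.
From mathcomp Require Import all_boot.
From mathcomp Require Import zify.

(** Reachability turns a DAG into a finite poset with the same longest chains,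
    and every edge is a comparable pair, so it suffices to bound the number of
    comparable pairs.  Reducedness says that two vertices of an interval of
    this poset lie on a common path; hence every interval is a chain
    ([reduced_interval_chain]).

    Delete the elements of the poset one at a time, the height bound [l] being
    kept fixed.  In a set [A] choose a minimal element [a] and a maximal element
    [b].  All comparable elements of [a] are above it, all those of [b] are below
    it, and the elements counted twice form the open interval from [a] to [b].
    That interval is a chain, so it has at most [l - 1] elements, and the two
    degrees add up to at most [#|A| + l - 1] ([card_up_down]).  One of [a], [b]
    thus has degree at most half of this, which is exactly the amount by which
    the bound grows from [#|A| - 1] to [#|A|] elements ([bound_step]).  Once
    [l] elements remain, the bound is the number of all pairs. *)

(** * Strict orders whose intervals are chains *)

(** An element of [A] with the fewest predecessors is minimal in [A], since a
    smaller element would have fewer. *)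
Lemma exists_minimal (V : finType) (r : rel V) (A : {set V}) :
    irreflexive r -> transitive r -> A != set0 ->
  exists2 a, a \in A & {in A, forall y, ~~ r y a}.
Proof.
move=> r_irr r_trans /set0Pn[x0 x0A].
case: (@arg_minnP V x0 (mem A) (fun x => #|[set y | r y x]|) x0A) => a aA amin.
exists a => // y yA; apply/negP=> rya.
have := amin y yA; rewrite leqNgt => /negP; apply.
apply/proper_card/properP; split; first last.
  by exists y; rewrite !inE ?r_irr.
by apply/subsetP=> z; rewrite !inE => /r_trans; apply.
Qed.

Section IntervalChains.
Variables (V : finType) (r : rel V).
Hypothesis r_irr : irreflexive r.
Hypothesis r_trans : transitive r.

Definition pairs_in (A : {set V}) : {set V * V} :=
  [set p | [&& p.1 \in A, p.2 \in A & r p.1 p.2]].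

(** By asymmetry a related pair is determined by its underlying 2-element
    set. *)
Lemma card_pairs_in (A : {set V}) : #|pairs_in A| <= 'C(#|A|, 2).
Proof.
rewrite -cards_draws.
have inj : {in pairs_in A &, injective (fun p : V * V => [set p.1; p.2])}.
  move=> [x y] [x' y']; rewrite !inE /= => /and3P[_ _ rxy] /and3P[_ _ rxy'] E.
  have asym u v : r u v -> r v u -> False.
    by move=> ruv /(r_trans _ _ _ ruv); rewrite r_irr.
  have: x \in [set x'; y'] by rewrite -E !inE eqxx.
  have: y \in [set x'; y'] by rewrite -E !inE eqxx orbT.
  rewrite !inE => /orP[]/eqP Ey /orP[]/eqP Ex; subst => //.
  - by rewrite r_irr in rxy.
  - by case: (asym _ _ rxy rxy').
  - by rewrite r_irr in rxy.
rewrite -(card_in_imset inj); apply/subset_leq_card/subsetP=> B.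
case/imsetP=> -[x y]; rewrite !inE /= => /and3P[xA yA rxy] ->.
have xy : x != y by apply: contraTneq rxy => ->; rewrite r_irr.
by rewrite cards2 xy andbT; apply/subsetP=> z; rewrite !inE => /orP[]/eqP->.
Qed.

(** A minimal element is the smaller one in all its pairs. *)
Lemma pairs_in_minimal (A : {set V}) a :
    a \in A -> {in A, forall y, ~~ r y a} ->
  #|pairs_in A| <= #|pairs_in (A :\ a)| + #|[set y in A | r a y]|.
Proof.
move=> aA amin; apply: leq_trans (leq_add (leqnn _) (leq_imset_card (pair a) _)).
apply: leq_trans (leq_card_setU _ _).
apply/subset_leq_card/subsetP=> -[x y]; rewrite !inE /= => /and3P[xA yA rxy].
rewrite xA yA rxy !andbT; case: (eqVneq x a) => [Ex|_] /=.
  by apply/imsetP; exists y; rewrite ?inE ?yA -?Ex.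
by case: eqP (rxy) => // -> /(negP (amin x xA)).
Qed.

Lemma pairs_in_maximal (A : {set V}) b :
    b \in A -> {in A, forall y, ~~ r b y} ->
  #|pairs_in A| <= #|pairs_in (A :\ b)| + #|[set y in A | r y b]|.
Proof.
move=> bA bmax.
apply: leq_trans (leq_add (leqnn _) (leq_imset_card (pair^~ b) _)).
apply: leq_trans (leq_card_setU _ _).
apply/subset_leq_card/subsetP=> -[x y]; rewrite !inE /= => /and3P[xA yA rxy].
rewrite xA yA rxy !andbT andbC; case: (eqVneq y b) => [Ey|_] /=.
  by apply/imsetP; exists x; rewrite ?inE ?xA -?Ey.
by case: eqP (rxy) => // -> /(negP (bmax y yA)).
Qed.

Hypothesis interval_chain : forall a b x y,
  r a x -> r x b -> r a y -> r y b -> [|| x == y, r x y | r y x].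
Variable l : nat.
Hypothesis height_le : forall v p, path r v p -> size p <= l.
Hypothesis l_gt0 : 0 < l.

(** The open interval from [a] to [b], sorted and with both ends added, is a
    chain with one step more than it has elements. *)
Lemma card_interval (S : {set V}) a b :
  {in S, forall x, r a x && r x b} -> #|S| <= l.-1.
Proof.
move=> Sab; pose le := relU eq_op r.
have le_trans : transitive le.
  move=> y x z /orP[/eqP-> //|rxy] /orP[/eqP<-|ryz]; apply/orP; right=> //.
  exact: r_trans rxy ryz.
have le_total : {in S &, total le}.
  move=> x y /Sab/andP[ax xb] /Sab/andP[ay yb]; rewrite /le /=.
  have := interval_chain _ _ _ _ ax xb ay yb.
  by case/or3P=> ->; rewrite ?orbT.
set s := sort le (enum S).
have s_r : path r a s.
  have sub_ar : all (mem S) (enum S) by apply/allP=> x; rewrite mem_enum.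
  have := sort_sorted_in le_total sub_ar; rewrite (sorted_pairwise le_trans).
  have : uniq s by rewrite sort_uniq enum_uniq.
  rewrite uniq_pairwise => s_neq s_le.
  have s_pw : pairwise r s.
    apply: sub_pairwise (_ : pairwise [rel x y | (x != y) && le x y] s).
      by move=> x y /= /andP[/negPf xy]; rewrite /le /= xy.
    by rewrite pairwise_relI s_neq.
  rewrite (path_pairwise r_trans) /= s_pw andbT; apply/allP=> x.
  by rewrite mem_sort mem_enum => /Sab/andP[].
case: (set_0Vmem S) => [->|[x xS]]; first by rewrite cards0.
have r_last : r (last a s) b.
  have : last a s \in s.
    have : 0 < size s by rewrite size_sort -cardE; apply/card_gt0P; exists x.
    by case: (s) => // y t _; rewrite /= mem_last.
  by rewrite mem_sort mem_enum => /Sab/andP[].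
have : path r a (rcons s b) by rewrite rcons_path s_r.
by move/height_le; rewrite size_rcons size_sort -cardE; case: (l).
Qed.

(** Only the elements strictly between [a] and [b] are counted twice.  If [a]
    is not below [b], there are none. *)
Lemma card_up_down (A : {set V}) a b :
  #|[set y in A | r a y]| + #|[set y in A | r y b]| <= #|A| + l.-1.
Proof.
rewrite -cardsUI; apply: leq_add.
  apply/subset_leq_card/subsetP=> y; rewrite !inE.
  by case/orP=> /andP[].
by apply: (@card_interval _ a b) => y; rewrite !inE => /andP[/andP[_ ->] /andP[]].
Qed.

(** Induction on the set, deleting whichever of a minimal and a maximal element
    has the smaller degree.  Only two properties of the bound matter: it covers
    all pairs of small sets, and it grows by at least half the degree sum allowed
    by [card_up_down]. *)
Lemma card_pairs_le (F : nat -> nat) :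
    (forall n, n <= l -> 'C(n, 2) <= F n) ->
    (forall n, l <= n -> F n + (n.+1 + l.-1)./2 <= F n.+1) ->
  forall A : {set V}, #|pairs_in A| <= F #|A|.
Proof.
move=> F_base F_step A; have [n] := ubnP #|A|.
elim: n A => // n IHn A; rewrite ltnS => cardA.
have [le_Al|lt_lA] := leqP #|A| l.
  exact: leq_trans (card_pairs_in A) (F_base _ le_Al).
have A_neq0 : A != set0 by rewrite -card_gt0; apply: leq_trans lt_lA.
have step c d : c \in A -> d <= (#|A| + l.-1)./2 ->
    #|pairs_in A| <= #|pairs_in (A :\ c)| + d -> #|pairs_in A| <= F #|A|.
  move=> cA led /leq_trans; apply.
  have EA : #|A| = #|A :\ c|.+1 by rewrite (cardsD1 c A) cA.
  have IH : #|pairs_in (A :\ c)| <= F #|A :\ c| by apply: IHn; rewrite -EA.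
  apply: leq_trans (leq_add IH led) _; rewrite EA; apply: F_step.
  by rewrite -ltnS -EA.
have [a aA amin] := exists_minimal V r A r_irr r_trans A_neq0.
have [b bA bmax] : exists2 b, b \in A & {in A, forall y, ~~ r b y}.
  (* A maximal element is minimal for the converse order. *)
  apply: (exists_minimal V (fun x y => r y x)) => //.
  by move=> y x z ryx rzy; apply: r_trans rzy ryx.
have := card_up_down A a b.
have := pairs_in_minimal A a aA amin; have := pairs_in_maximal A b bA bmax.
set D := #|[set y in A | r y b]|; set U := #|[set y in A | r a y]|.
move=> leD leU sumUD.
have [le_UD|/ltnW le_DU] := leqP U D.
  by apply: (step a U) => //; lia.
by apply: (step b D) => //; lia.
Qed.

End IntervalChains.

(** * The size of the bound *)

Lemma count_parity (b : bool) j :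
  \sum_(i < j) (odd i != b) = if b then uphalf j else j./2.
Proof.
elim: j => [|j IHj]; first by rewrite big_ord0; case: b.
rewrite big_ord_recr IHj /= uphalf_half {IHj}.
by case: b; case: (odd j) => /=; lia.
Qed.

(** The vertex [j] of the bipartite Turan graph is adjacent to the smaller
    vertices of the other parity, and there are [uphalf j] of these. *)
Lemma turan_edges2 m : turan_edges m 2 = \sum_(j < m) uphalf j.
Proof.
rewrite /turan_edges cardsE -sum1_card big_mkcond /=.
rewrite -(pair_bigA _ (fun i j : 'I_m =>
  if (i < j) && turan_rel 2 i j then 1 else 0)) exchange_big /=.
apply: eq_bigr => j _.
transitivity (\sum_(i < j) (odd i != odd j)).
  rewrite (big_ord_widen m (fun i => (odd i != odd j) : nat) (ltnW (ltn_ord j))).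
  rewrite [RHS]big_mkcond; apply: eq_bigr => i _; rewrite /turan_rel !modn2.
  by case: (i < j) => //=; case: (odd i); case: (odd j).
by rewrite count_parity uphalf_half; case: (odd j).
Qed.

Definition bound (l n : nat) := turan_edges (n - l + 1) 2 + T1 n l.

Lemma bound_base l n : n <= l -> 'C(n, 2) <= bound l n.
Proof.
rewrite /bound /T1 -subn_eq0 => /eqP->; rewrite add0n subn0; exact: leq_addl.
Qed.

(** With [m := n - l + 1], passing from [n] to [n + 1] adds [(m + 1) / 2] edges
    to the Turan graph and [n - m = l - 1] to the other summand. *)
Lemma bound_step l n : 0 < l -> l <= n ->
  bound l n + (n.+1 + l.-1)./2 <= bound l n.+1.
Proof.
move=> l_gt0 le_ln; rewrite /bound /T1 !turan_edges2 subSn // !addn1.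
rewrite [in leqRHS]big_ord_recr !binS !bin1 !bin0 /=.
have : 'C((n - l).+1, 2) <= 'C(n, 2) by apply: leq_bin2l; lia.
rewrite binS bin1; move: (\sum_(i < _) _) 'C(n - l, 2) 'C(n, 2) => S B C.
by have := odd_double_half (n - l); lia.
Qed.

(** * Reachability in a directed acyclic graph *)

Section Reachability.
Variables (V : finType) (e : rel V).
Hypothesis hdag : is_dag e.

Definition reach : rel V := [rel x y | (x != y) && connect e x y].

Lemma closed_path_nil x p : path e x p -> last x p = x -> p = [::].
Proof.
case/lastP: p => // p z; rewrite last_rcons => ep Ez; move: ep.
by rewrite Ez => /(hdag (x :: p)).
Qed.

Lemma connect_antisym x y : connect e x y -> connect e y x -> x = y.
Proof.
case/connectP=> p ep Ey /connectP[q eq Ex].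
have: p ++ q = [::].
  apply: (closed_path_nil x); first by rewrite cat_path ep -Ey.
  by rewrite last_cat -Ey.
by case: p Ey {ep} => [|z p] // ->.
Qed.

Lemma reach_irr : irreflexive reach.
Proof. by move=> x; rewrite /reach /= eqxx. Qed.

Lemma reach_trans : transitive reach.
Proof.
move=> y x z /= /andP[xy cxy] /andP[yz cyz].
rewrite /reach /= (connect_trans cxy cyz) andbT.
by apply: contra xy => /eqP Ex; subst; rewrite (connect_antisym _ _ cxy cyz).
Qed.

Lemma edge_reach x y : e x y -> reach x y.
Proof.
move=> exy; rewrite /reach /= (connect1 exy) andbT; apply/eqP=> Exy.
by subst; have /hdag: cycle e [:: y] by rewrite /= exy.
Qed.

(** Passing to reachability does not create longer chains: each step of a chain
    can be refined to a path with at least one edge. *)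
Lemma reach_path_refine v p : path reach v p ->
  exists2 q, path e v q & size p <= size q.
Proof.
elim: p v => [|x p IHp] v /=; first by exists [::].
case/andP=> /andP[vx /connectP[q0 eq0 Ex]] /IHp[q eq le_pq].
exists (q0 ++ q); first by rewrite cat_path eq0 -Ex.
by rewrite size_cat; case: q0 Ex vx {eq0} => [/= ->|]; rewrite ?eqxx //= => *; lia.
Qed.

Lemma path_comparable v q x y : path e v q ->
  x \in v :: q -> y \in v :: q -> connect e x y || connect e y x.
Proof.
move=> eq.
have cq : pairwise (connect e) (v :: q).
  rewrite -(sorted_pairwise (@connect_trans _ e)) /=.
  exact: sub_path (@connect1 _ e) _ _ eq.
move=> /(nthP v)[i iq <-] /(nthP v)[j jq <-].
have /(pairwiseP v) cmp := cq.
case: (ltngtP i j) => [ij|ji|->]; last by rewrite connect0.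
- by rewrite (cmp i j).
- by rewrite (cmp j i) ?orbT.
Qed.

(** A path from [a] to [b] through [x] and one through [y] are both contained in
    a third path, along which [x] and [y] are comparable. *)
Lemma reduced_interval_chain (hred : reduced e) a b x y :
    reach a x -> reach x b -> reach a y -> reach y b ->
  [|| x == y, reach x y | reach y x].
Proof.
have through z : reach a z -> reach z b ->
    exists2 p, dipath e a b p & z \in a :: p.
  case/andP=> _ /connectP[p ep Ez] /andP[_ /connectP[q eq Eb]].
  exists (p ++ q); first by rewrite /dipath cat_path ep -Ez eq last_cat -Ez -Eb /=.
  by rewrite -cat_cons mem_cat Ez mem_last.
move=> ax xb ay yb; have [p pab xp] := through x ax xb.
have [p' p'ab yp'] := through y ay yb.
have [q [/andP[eq _] pq p'q]] := hred _ _ _ _ pab p'ab.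
have := path_comparable _ _ _ _ eq (pq _ xp) (p'q _ yp').
by rewrite /reach /= (eq_sym y); case: (x == y).
Qed.

End Reachability.

Theorem corollary3p18 (V : finType) (e : rel V) (n l : nat)
    (hdag : is_dag e) (hn : #|V| = n)
    (hl : longest_dipath_length e l) (l_ge1 : 1 <= l)
    (hred : reduced e) :
  #|edges e| <= turan_edges (n - l + 1) 2 + T1 n l.
Proof.
case: hl => _ height_e.
have height_r v p : path (reach V e) v p -> size p <= l.
  case/reach_path_refine=> q eq /leq_trans; apply.
  by apply: (height_e v (last v q)); rewrite /dipath eq eqxx.
have := @card_pairs_le V (reach V e) (reach_irr V e) (reach_trans V e hdag)
  (reduced_interval_chain V e hred) l height_r
  l_ge1 (bound l) (bound_base l) (fun m => bound_step l m l_ge1) setT.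
rewrite cardsT hn; apply: leq_trans.
apply/subset_leq_card/subsetP=> -[x y]; rewrite !inE /=.
exact: edge_reach.
Qed.
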